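(* Let $x^{(1)},\dots,x^{(n)}\in[0,1]^d$, $y=(y_1,\dots,y_n)\in\mathbb{R}^n$, $V>0$, and consider the problem $$(\mathrm{P})\qquad \hat f^{d,s}_{n,V}\in\underset{f}{\operatorname{argmin}}\Big\{\sum_{i=1}^n\big(y_i-f(x^{(i)})\big)^2:\ f\in\mathcal{F}^{d,s}_{\infty\text{-mars}}\text{ and }V_{\text{mars}}(f)\le V\Big\}.$$ For each $k\in[d]$ let $0=u^{(k)}_0<u^{(k)}_1<\dots<u^{(k)}_{n_k}=1$ be the distinct elements of the set $\mathcal{U}_k=\{0,x^{(1)}_k,\dots,x^{(n)}_k,1\}$. Let $$J=\Big\{(\alpha,l):\ \alpha\in\{0,1\}^d\setminus\{\mathbf 0\},\ |\alpha|\le s,\ l\in\prod_{k\in S(\alpha)}\{0,1,\dots,n_k-1\}\Big\}$$ and let $M$ be the $n\times|J|$ matrix with columns indexed by $(\alpha,l)\in J$ and entries $$M_{i,(\alpha,l)}=\prod_{k\in S(\alpha)}\big(x^{(i)}_k-u^{(k)}_{l_k}\big)_+ ,\qquad i\in[n],\ (\alpha,l)\in J.$$ Let $(\hat a_{\mathbf 0},\hat\gamma^{d,s}_{n,V})\in\mathbb{R}\times\mathbb{R}^{|J|}$ be a solution to the finite-dimensional lasso problem $$(\hat a_{\mathbf 0},\hat\gamma^{d,s}_{n,V})\in\underset{a_{\mathbf 0}\in\mathbb{R},\ \gamma\in\mathbb{R}^{|J|}}{\operatorname{argmin}}\Big\{\|y-a_{\mathbf 0}\mathbf 1-M\gamma\|_2^2:\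 \sum_{(\alpha,l)\in J,\ l\ne\mathbf 0}|\gamma_{\alpha,l}|\le V\Big\},$$ where $\mathbf 1=(1,\dots,1)$. Then the function $f$ on $[0,1]^d$ defined by $$f(x_1,\dots,x_d)=\hat a_{\mathbf 0}+\sum_{(\alpha,l)\in J}\big(\hat\gamma^{d,s}_{n,V}\big)_{\alpha,l}\prod_{k\in S(\alpha)}\big(x_k-u^{(k)}_{l_k}\big)_+$$ is a solution to $(\mathrm{P})$. The problem $(\mathrm{P})$ can have multiple solutions, but every solution $\hat f^{d,s}_{n,V}$ of $(\mathrm P)$ satisfies, for every $i\in[n]$, $$\hat f^{d,s}_{n,V}(x^{(i)})=\hat a_{\mathbf 0}+\big(M\hat\gamma^{d,s}_{n,V}\big)_i=\hat a_{\mathbf 0}+\sum_{(\alpha,l)\in J}\big(\hat\gamma^{d,s}_{n,V}\big)_{\alpha,l}\prod_{k\in S(\alpha)}\big(x^{(i)}_k-u^{(k)}_{l_k}\big)_+ .$$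
   Context: Throughout $d\ge1$ and $1\le s\le d$ are integers, $[m]=\{1,\dots,m\}$, $u_+=\max\{u,0\}$, and $\mathbf 0=(0,\dots,0)$ (of the appropriate dimension). For $\alpha\in\{0,1\}^d$ put $S(\alpha)=\{j\in[d]:\alpha_j=1\}$ and $|\alpha|=|S(\alpha)|$; $t^{(\alpha)}$ denotes the vector $(t_j,\ j\in S(\alpha))$. For $a_{\mathbf 0}\in\mathbb{R}$ and a collection $\{\nu_\alpha\}$ in which, for each $\alpha\in\{0,1\}^d\setminus\{\mathbf 0\}$ with $|\alpha|\le s$, $\nu_\alpha$ is a finite (Borel) signed measure on $[0,1)^{|\alpha|}$ (coordinates indexed by $S(\alpha)$), define on $[0,1]^d$ $$f_{a_{\mathbf 0},\{\nu_\alpha\}}(x_1,\dots,x_d)=a_{\mathbf 0}+\sum_{\substack{\alpha\in\{0,1\}^d\setminus\{\mathbf 0\}\\|\alpha|\le s}}\int_{[0,1)^{|\alpha|}}\prod_{j\in S(\alpha)}(x_j-t_j)_+\,d\nu_\alpha(t^{(\alpha)}).$$ $\mathcal{F}^{d,s}_{\infty\text{-mars}}$ is the class of all such functions. The complexity of $f=f_{a_{\mathbf 0},\{\nu_\alpha\}}$ is $$V_{\text{mars}}(f)=\sum_{\substack{\alpha\in\{0,1\}^d\setminus\{\mathbf 0\}\\|\alpha|\le s}}|\nu_\alpha|\big([0,1)^{|\alpha|}\setminus\{\mathbf 0\}\big),$$ where $|\nu|$ is the (total) variation measure of $\nu$; this is well defined because $a_{\mathbf 0}$ and the $\nu_\alpha$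 are uniquely determined by $f$. $x^{(i)}_k$ denotes the $k$-th coordinate of $x^{(i)}$. *)

(* Defs.v *)
From HB Require Import structures.
From mathcomp Require Import all_boot all_order all_algebra.
From mathcomp Require Import all_classical all_reals all_analysis.
Set Implicit Arguments.
Unset Strict Implicit.
Unset Printing Implicit Defensive.
Import Order.TTheory GRing.Theory Num.Theory.
Import numFieldNormedType.Exports.
Local Open Scope classical_set_scope.
Local Open Scope ring_scope.

Definition argmin (R : realType) (T : Type) (C : set T) (F : T -> R) : set T :=
  [set z | C z /\ forall w, C w -> F z <= F w].

Section signed_measure.
Context (R : realType) (d : measure_display) (T : measurableType d).
Variable nu : {charge set T -> \bar R}.

(* The Jordan decomposition and the variation do not depend on the chosen
   Hahn decomposition (Hahn_decomposition_uniq). *)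
Definition hahn_sig : {PN : set T * set T | hahn_decomposition nu PN.1 PN.2} :=
  cid (let: ex_intro P (ex_intro N h) := Hahn_decomposition nu in
       ex_intro (fun PN => hahn_decomposition nu PN.1 PN.2) (P, N) h).

Definition charge_tv : set T -> \bar R := charge_variation (svalP hahn_sig).

Definition charge_integral (f : T -> R) : R :=
  \int[jordan_pos (svalP hahn_sig)]_t f t
  - \int[jordan_neg (svalP hahn_sig)]_t f t.
End signed_measure.

Definition ucube (R : realType) (d : nat) : Type :=
  {x : d.-tuple R | [forall k, 0 <= tnth x k <= 1]}.

(* [0,1)^m, with the trace of the Borel sigma-algebra of R^m *)
Definition hcube (R : realType) (m : nat) : Type :=
  {t : m.-tuple R | [forall i, 0 <= tnth t i < 1]}.

Lemma hcube0_subproof (R : realType) (m : nat) :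
  [forall i, 0 <= tnth [tuple of nseq m (0 : R)] i < 1].
Proof. by apply/forallP => i; rewrite tnth_nseq lexx ltr01. Qed.

Definition hcube0 (R : realType) (m : nat) : hcube R m :=
  exist _ [tuple of nseq m 0] (hcube0_subproof R m).

HB.instance Definition _ (R : realType) (m : nat) := Choice.on (hcube R m).
HB.instance Definition _ (R : realType) (m : nat) :=
  isPointed.Build (hcube R m) (hcube0 R m).

Definition bcube (R : realType) (m : nat) :=
  g_sigma_algebra_preimageType (fun t : hcube R m => sval t : m.-tuple R).

(* A vector alpha in {0,1}^d is represented by its support S(alpha); this is
   the set of nonzero alpha with |alpha| <= s.  Vectors indexed by S(alpha) are
   indexed by 'I_#|S(alpha)| through the enumeration enum_val of S(alpha). *)
Definition alphas (d s : nat) : finType :=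
  {A : {set 'I_d} | (A != finset.set0) && (#|A| <= s)%N}.

Section mars.
Context (R : realType) (d s : nat).

(* prod_(j in S(alpha)) (x_j - t_j)_+ *)
Definition hinge_prod (al : alphas d s) (t : 'I_#|sval al| -> R) (x : ucube R d)
    : R :=
  \prod_(i < #|sval al|) Num.max (tnth (sval x) (enum_val i) - t i) 0.

Definition signed_measures : Type :=
  forall al : alphas d s, {charge set (bcube R #|sval al|) -> \bar R}.

Definition mars_fun (a : R) (nu : signed_measures) : ucube R d -> R :=
  fun x => a + \sum_(al : alphas d s)
    charge_integral (nu al) (fun t => hinge_prod (tnth (sval t)) x).

Definition mars_class : set (ucube R d -> R) :=
  [set f | exists a nu, f = mars_fun a nu].

Definition mars_complexity (nu : signed_measures) : \bar R :=
  (\sum_(al : alphas d s)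
    charge_tv (nu al) (~` [set (hcube0 R #|sval al| : bcube R _)]))%E.

(* For f in mars_class the set below is a singleton, as a and nu are uniquely
   determined by mars_fun a nu; the default value 0 is only used for f outside
   mars_class. *)
Definition Vmars (f : ucube R d -> R) : \bar R :=
  xget 0%E [set v | exists a nu, f = mars_fun a nu /\ v = mars_complexity nu].

Section data.
Context (n : nat) (x : 'I_n -> ucube R d) (y : 'I_n -> R) (V : R).

Definition mars_solutions : set (ucube R d -> R) :=
  argmin [set f | mars_class f /\ (Vmars f <= V%:E)%E]
         (fun f => \sum_(i < n) (y i - f (x i)) ^+ 2).

(* the increasing sequence u^(k)_0 < ... < u^(k)_{n_k} *)
Definition knots (k : 'I_d) : seq R :=
  sort <=%R
    (undup [:: 0, 1 & [seq tnth (sval (x i)) k | i <- enum 'I_n]]).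
Definition nknots (k : 'I_d) : nat := (size (knots k)).-1.
Definition knot (k : 'I_d) (l : nat) : R := nth 0 (knots k) l.

Definition lindex (al : alphas d s) : finType :=
  {dffun forall i : 'I_#|sval al|, 'I_(nknots (enum_val i))}.

Definition J : finType := {al : alphas d s & lindex al}.

Definition hinge_basis (p : J) : ucube R d -> R :=
  hinge_prod (fun i => knot (enum_val i) (tagged p i)).

Definition design (i : 'I_n) (p : J) : R := hinge_basis p (x i).

Definition lneq0 (p : J) : bool := [exists i, tagged p i != 0%N :> nat].

Definition lasso_solutions : set (R * (J -> R)) :=
  argmin [set ag | \sum_(p : J | lneq0 p) `|ag.2 p| <= V]
         (fun ag => \sum_(i < n)
            (y i - ag.1 - \sum_(p : J) design i p * ag.2 p) ^+ 2).

Definition lasso_fun (a : R) (g : J -> R) : ucube R d -> R :=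
  fun z => a + \sum_(p : J) g p * hinge_basis p z.
End data.
End mars.

(* Main.v *)
(* A hinge product t |-> prod_j (x_j - t_j)_+ whose x has all its coordinates
   among the knots is, on each cell of the knot grid, affine in each t_j;
   hence it equals its interpolation by products of hat functions.
   Integrating these products against nu_alpha replaces nu_alpha by a measure
   carried by the grid, without changing the values at the data points or
   increasing the complexity: the products are nonnegative, have sum at most 1,
   and those of the nonzero grid points vanish at 0.  So (P) has the optimal
   value of the lasso problem, and strict convexity of the squared loss makes
   the fitted values unique.
   The complexity of the lasso function is only bounded by the l1 norm because
   the measures representing a function are unique: restricting x to the
   coordinates in alpha isolates the integrals of index contained in alpha, and
   difference quotients of hinges converge to indicators of boxes, which form a
   pi-system generating the Borel sets. *)
Require Import Defs.
From mathcomp Require Import all_boot all_order all_algebra.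
From mathcomp Require Import all_classical all_reals all_analysis.
From mathcomp Require Import measurable_realfun.
From mathcomp Require Import ring lra.
Set Implicit Arguments.
Unset Strict Implicit.
Unset Printing Implicit Defensive.
Import Order.TTheory GRing.Theory Num.Theory.
Import numFieldNormedType.Exports.
Local Open Scope classical_set_scope.
Local Open Scope ring_scope.

(** * Integration against measures and charges *)

Section Rintegral.
Context (R : realType) (d : measure_display) (T : measurableType d).
Implicit Types (mu : {measure set T -> \bar R}) (f : T -> R).

(** The integrands used throughout: against a finite measure they are integrable, so linearity of
    the integral needs no further side condition. *)
Definition bounded_measurable f : Prop :=
  measurable_fun setT f /\ exists M, forall t, `|f t| <= M.

Lemma bounded_measurable_integrable mu f :
  (mu setT < +oo)%E -> bounded_measurable f ->
  mu.-integrable setT (EFin \o f).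
Proof.
move=> mufin [mf [M fM]]; apply: measurable_bounded_integrable => //.
exists M; split; first exact: num_real.
by move=> x Mx t _; apply: le_trans (fM t) (ltW Mx).
Qed.

Lemma finite_measure_lty (mu : {finite_measure set T -> \bar R}) :
  (mu setT < +oo)%E.
Proof. by rewrite ltey_eq fin_num_measure. Qed.

Lemma Rintegral_lincomb mu (I : finType) (P : pred I) (c : I -> R)
    (f : I -> T -> R) :
  (mu setT < +oo)%E -> (forall i, bounded_measurable (f i)) ->
  \int[mu]_t (\sum_(i | P i) c i * f i t) = \sum_(i | P i) c i * \int[mu]_t f i t.
Proof.
move=> mufin bf.
have intf i : mu.-integrable setT (EFin \o f i).
  exact: bounded_measurable_integrable.
have intcf i : mu.-integrable setT (fun t => (c i)%:E * (f i t)%:E)%E.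
  exact: (integrableZl measurableT (c i) (intf i)).
rewrite /Rintegral.
transitivity (fine (\int[mu]_t (\sum_(i | P i) ((c i)%:E * (f i t)%:E))%E)).
  by congr fine; apply: eq_integral => t _; rewrite -sumEFin; apply: eq_bigr.
rewrite integral_sum// -sum_fine/=; last first.
  by move=> i _; exact: integrable_fin_num.
apply: eq_bigr => i _.
rewrite (integralZl measurableT (intf i) (c i)) fineM//.
exact: (integrable_fin_num measurableT (intf i)).
Qed.

Lemma Rintegral_measure_add (m1 m2 : {measure set T -> \bar R}) f :
  (m1 setT < +oo)%E -> (m2 setT < +oo)%E -> bounded_measurable f ->
  \int[measure_add m1 m2]_t f t = \int[m1]_t f t + \int[m2]_t f t.
Proof.
move=> m1fin m2fin bf.
have i1 := bounded_measurable_integrable m1fin bf.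
have i2 := bounded_measurable_integrable m2fin bf.
by rewrite /Rintegral (integral_measure_add measurableT i1 i2) fineD//;
  exact: integrable_fin_num.
Qed.

Lemma eq_measure_Rintegral (m1 m2 : {measure set T -> \bar R}) f :
  (forall A, measurable A -> m1 A = m2 A) ->
  \int[m1]_t f t = \int[m2]_t f t.
Proof.
by move=> m12; rewrite /Rintegral (eq_measure_integral m2)// => A mA _; exact: m12.
Qed.

Lemma measure_add_apply (m1 m2 : {measure set T -> \bar R}) A :
  (measure_add m1 m2 : {measure set T -> \bar R}) A = (m1 A + m2 A)%E.
Proof. exact: measure_addE. Qed.

Lemma measure_add_lty (m1 m2 : {measure set T -> \bar R}) :
  (m1 setT < +oo)%E -> (m2 setT < +oo)%E -> (measure_add m1 m2 setT < +oo)%E.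
Proof. by move=> m1oo m2oo; rewrite measure_addE lte_add_pinfty. Qed.

Lemma mscale_diracE (w : R) (w0 : 0 <= w) (u : T) A :
  (mscale (NngNum w0) \d_u : {measure set T -> \bar R}) A = (w * (u \in A)%:R)%:E.
Proof. by rewrite EFinM -diracE. Qed.

Lemma mscale_dirac_lty (w : R) (w0 : 0 <= w) (u : T) :
  (mscale (NngNum w0) \d_u setT < +oo :> \bar R)%E.
Proof. by rewrite mscale_diracE ltry. Qed.

Lemma Rintegral_mscale_dirac (w : R) (w0 : 0 <= w) (u : T) f :
  measurable_fun setT f -> (forall t, 0 <= f t) ->
  \int[mscale (NngNum w0) \d_u]_t f t = w * f u.
Proof.
move=> /measurable_EFinP mf f0.
rewrite /Rintegral ge0_integral_mscale//; last by move=> t _; rewrite lee_fin.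
by rewrite integral_dirac// diracE in_setT mul1e.
Qed.

(** Moving every negative term across, including the negative part of [c], turns the hypothesis into
    an equality of two finite measures. Arbitrary pairs are allowed because the Jordan parts of a
    charge change unpredictably when an atom is added. *)
Lemma Rintegral_sub_add_dirac (p1 n1 p2 n2 : {measure set T -> \bar R})
    (c : R) (u : T) f :
  fin_num_fun p1 -> fin_num_fun n1 -> fin_num_fun p2 -> fin_num_fun n2 ->
  (forall A, measurable A -> p1 A - n1 A = p2 A - n2 A + c%:E * \d_u A)%E ->
  bounded_measurable f -> (forall t, 0 <= f t) ->
  \int[p1]_t f t - \int[n1]_t f t =
  \int[p2]_t f t - \int[n2]_t f t + c * f u.
Proof.
move=> fp1 fn1 fp2 fn2 pn bf f0.
have Hp : 0 <= Num.max c 0 by rewrite le_max lexx orbT.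
have Hn : 0 <= Num.max (- c) 0 by rewrite le_max lexx orbT.
have cE : c = Num.max c 0 - Num.max (- c) 0.
  by case: (leP c 0) => c0; case: (leP (- c) 0) => ?; lra.
have mf : measurable_fun setT f by case: bf.
pose dp : {measure set T -> \bar R} := mscale (NngNum Hp) \d_u.
pose dn : {measure set T -> \bar R} := mscale (NngNum Hn) \d_u.
have foo (m : {measure set T -> \bar R}) : fin_num_fun m -> (m setT < +oo)%E.
  by move=> fm; rewrite ltey_eq fm.
have [p1oo n1oo p2oo n2oo] := And4 (foo _ fp1) (foo _ fn1) (foo _ fp2) (foo _ fn2).
have dpoo : (dp setT < +oo)%E by exact: mscale_dirac_lty.
have dnoo : (dn setT < +oo)%E by exact: mscale_dirac_lty.
pose m1 := measure_add (measure_add p1 n2) dn.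
pose m2 := measure_add (measure_add n1 p2) dp.
have m12 : \int[m1]_t f t = \int[m2]_t f t.
  apply: eq_measure_Rintegral => A mA; rewrite /m1 /m2 !measure_add_apply.
  have := pn A mA; rewrite !mscale_diracE.
  rewrite -[X in (c%:E * X)%E]/(((u \in A)%:R)%:E).
  have := fp1 A mA.
  have := fp2 A mA.
  have := fn1 A mA.
  have := fn2 A mA.
  move: (p1 A) (p2 A) (n1 A) (n2 A) => [a1| |] [a2| |] [b1| |] [b2| |]// _ _ _ _.
  rewrite -!EFinB -!EFinM -!EFinD => -[] e. congr EFin.
  move: e; rewrite {1}cE; move: (Num.max c 0) (Num.max (- c) 0) => y x.
  by case: (u \in A) => /=; lra.
move: m12; rewrite /m1 /m2 !Rintegral_measure_add//; try exact: measure_add_lty.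
rewrite !Rintegral_mscale_dirac//=.
have := congr1 (fun z => z * f u) cE; rewrite /= mulrBl; lra.
Qed.

End Rintegral.

Section charge_integral.
Context (R : realType) (d : measure_display) (T : measurableType d).
Implicit Types (nu : {charge set T -> \bar R}) (f : T -> R).

Definition pos_part nu : {finite_measure set T -> \bar R} :=
  jordan_pos (svalP (hahn_sig nu)).

Definition neg_part nu : {finite_measure set T -> \bar R} :=
  jordan_neg (svalP (hahn_sig nu)).

Lemma charge_integralE nu f :
  charge_integral nu f = \int[pos_part nu]_t f t - \int[neg_part nu]_t f t.
Proof. by []. Qed.

Lemma charge_tvE nu A : charge_tv nu A = (pos_part nu A + neg_part nu A)%E.
Proof. by []. Qed.

Lemma charge_jordan nu A : measurable A ->
  nu A = (pos_part nu A - neg_part nu A)%E.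
Proof.
move=> mA; rewrite (jordan_decomp (svalP (hahn_sig nu)) mA).
by congr (_ + _)%E; exact: mulN1e.
Qed.

Lemma charge_integral_lincomb nu (I : finType) (P : pred I) (c : I -> R)
    (f : I -> T -> R) :
  (forall i, bounded_measurable (f i)) ->
  charge_integral nu (fun t => \sum_(i | P i) c i * f i t) =
  \sum_(i | P i) c i * charge_integral nu (f i).
Proof.
move=> bf; rewrite charge_integralE !Rintegral_lincomb//;
  [|exact: finite_measure_lty..].
by rewrite -sumrB; apply: eq_bigr => i _; rewrite charge_integralE mulrBr.
Qed.

Lemma charge_integral_add_dirac nu1 nu2 (c : R) (u : T) f :
  (forall A, measurable A -> nu1 A = (nu2 A + c%:E * \d_u A)%E) ->
  bounded_measurable f -> (forall t, 0 <= f t) ->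
  charge_integral nu1 f = charge_integral nu2 f + c * f u.
Proof.
move=> nu12 bf f0; rewrite !charge_integralE.
apply: Rintegral_sub_add_dirac => //; try by move=> A; exact: fin_num_measure.
by move=> A mA; rewrite -!charge_jordan// nu12.
Qed.

(** A list of weighted atoms, so that integrals are computed by adding one Dirac mass at a time. *)
Fixpoint discrete_charge (s : seq (R * T)) : {charge set T -> \bar R} :=
  if s is (c, u) :: s' then
    cadd (discrete_charge s') (cscale c (charge_of_finite_measure \d_u))
  else czero.

Lemma discrete_chargeE s A :
  discrete_charge s A = (\sum_(p <- s) p.1 * \1_A p.2)%:E.
Proof.
elim: s => [|[c u] s IH]; first by rewrite big_nil.
rewrite big_cons /= /cadd/= IH /cscale/= /charge_of_finite_measure diracE.
by rewrite -EFinM -EFinD addrC indicE.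
Qed.

Lemma charge_integral_discrete s f :
  bounded_measurable f -> (forall t, 0 <= f t) ->
  charge_integral (discrete_charge s) f = \sum_(p <- s) p.1 * f p.2.
Proof.
move=> bf f0; elim: s => [|[c u] s IH].
  (* The two Jordan parts of the zero charge agree on measurable sets, so their integrals cancel. *)
  rewrite big_nil charge_integralE; apply/eqP; rewrite subr_eq0; apply/eqP.
  apply: eq_measure_Rintegral => A mA.
  have := charge_jordan (discrete_charge [::]) mA.
  rewrite discrete_chargeE big_nil => /esym/eqP; rewrite sube_eq ?add0e.
  - by move=> /eqP.
  - by apply: fin_num_measure.
  - by rewrite fin_num_adde_defl// fin_num_measure.
rewrite big_cons (@charge_integral_add_dirac _ (discrete_charge s) c u)//.
by rewrite IH addrC.
Qed.

(* The charge is only known to agree with the discrete one on measurable sets,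
   which is all that uniqueness of the representing measures provides. *)
Lemma charge_tv_discrete_le nu s A : measurable A ->
  (forall B, measurable B -> nu B = discrete_charge s B) ->
  (charge_tv nu A <= (\sum_(p <- s | p.2 \in A) `|p.1|)%:E)%E.
Proof.
move=> mA nuE; rewrite /charge_tv /charge_variation /=.
case: (hahn_sig nu) => [[P N]] /= h; have [[mP _] [mN _] _ PN0] := h.
rewrite !jordan_posE cjordan_posE jordan_negE cjordan_negE /crestr0 /=.
rewrite !mem_set// /crestr !nuE; [|exact: measurableI..].
rewrite !discrete_chargeE -EFinN -EFinD lee_fin -sumrB.
rewrite [leRHS]big_mkcond/=; apply: ler_sum => -[c u] _ /=.
rewrite !indicE !in_setI; case: ifPn => uA /=; last first.
  by rewrite !mulr0 subrr.
(* An atom lies in at most one of the two Hahn sets, so it contributes [c], [- c] or 0, each at most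
   the absolute value of [c]. *)
have : ~~ ((u \in P) && (u \in N)).
  by rewrite -in_setI PN0 in_set0.
case: (u \in P); case: (u \in N) => //= _; rewrite ?mulr1 ?mulr0 ?subr0 ?sub0r.
- exact: ler_norm.
- by rewrite -normrN ler_norm.
- exact: normr_ge0.
Qed.

End charge_integral.

(** * Charges on the cube are determined by their hinge integrals *)

Section hcube.
Context (R : realType) (m : nat).
Local Notation T := (bcube R m).
Implicit Types (t : T) (x b : 'I_m -> R).

Definition hinge x t : R := \prod_(i < m) Num.max (x i - tnth (sval t) i) 0.

Lemma hcube_ge0 t i : 0 <= tnth (sval t) i.
Proof. by case: t => t /= /forallP/(_ i)/andP[]. Qed.

Lemma hcube_lt1 t i : tnth (sval t) i < 1.
Proof. by case: t => t /= /forallP/(_ i)/andP[]. Qed.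

Lemma measurable_coord i : measurable_fun setT (fun t => tnth (sval t) i).
Proof.
have msval : measurable_fun [set: T] (fun t => sval t : m.-tuple R).
  by move=> _ B mB; rewrite setTI; exists B => //; rewrite setTI.
exact: (measurableT_comp (measurable_tnth i) msval).
Qed.

Lemma hinge_ge0 x t : 0 <= hinge x t.
Proof. by apply: prodr_ge0 => i _; rewrite le_max lexx orbT. Qed.

(** Common source of integrability for hinges, box steps and grid weights, all products of
    one-variable factors with values in [0,1]. *)
Lemma bounded_measurable_prod (h : 'I_m -> R -> R) :
  (forall i, measurable_fun setT (h i)) ->
  (forall i u, 0 <= u < 1 -> 0 <= h i u <= 1) ->
  bounded_measurable (fun t => \prod_(i < m) h i (tnth (sval t) i)).
Proof.
move=> mh h01; split.
  apply: measurable_prod => i _.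
  exact: (measurableT_comp (mh i) (measurable_coord i)).
exists 1 => t.
have h01t i : 0 <= h i (tnth (sval t) i) <= 1.
  by apply: h01; rewrite hcube_ge0 hcube_lt1.
rewrite ger0_norm; last by apply: prodr_ge0 => i _; case/andP: (h01t i).
by apply: Num.Theory.prodr_ile1 => i _; exact: h01t.
Qed.

Lemma bounded_measurable_hinge x : (forall i, 0 <= x i <= 1) ->
  bounded_measurable (hinge x).
Proof.
move=> x01; apply: (@bounded_measurable_prod (fun i u => Num.max (x i - u) 0)).
  move=> i; apply: measurable_maxr => //.
  exact: measurable_funB.
move=> i u /andP[u0 u1]; have /andP[x0 x1] := x01 i.
rewrite le_max lexx orbT/= ge_max ler01 andbT; lra.
Qed.

Definition box b : set T := [set t | forall i, tnth (sval t) i < b i].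

Lemma measurable_box b : measurable (box b).
Proof.
rewrite [box b](_ : _ = \bigcap_(i in [set: 'I_m])
    ((fun t => tnth (sval t) i) @^-1` `]-oo, b i[)); last first.
  apply/seteqP; split=> [t tb i _|t tb i]; rewrite /= ?in_itv/= ?tb//.
  by have := tb i I; rewrite /= in_itv.
apply: fin_bigcap_measurable => [|i _]; first exact: finite_finset.
by rewrite -[X in measurable X]setTI; exact: measurable_coord.
Qed.

Definition boxes : set (set T) := [set box b | b in setT].

Lemma measurable_boxesE : @measurable _ T = <<s boxes >>.
Proof.
apply/seteqP; split; last first.
  apply: smallest_sub; first exact: sigma_algebra_measurable.
  by move=> _ [b _ <-]; exact: measurable_box.
move=> _ [B mB <-].
pose T' := g_sigma_algebraType boxes.
suff msval : measurable_fun [set: T'] (fun t : T' => sval t : m.-tuple R).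
  exact: (msval measurableT B mB).
apply/measurable_fun_tnthP => i.
apply: (measurability _ (RGenInftyO.measurableE R)).
move=> _ [_ [c ->] <-]; rewrite setTI.
(* Since coordinates are below 1, the bound 1 is no constraint, and this box is the half-space given
   by the [i]-th coordinate alone. *)
apply: sub_sigma_algebra; exists (fun j => if j == i then c else 1) => //.
apply/seteqP; split => t /=; rewrite in_itv/=.
  by move=> /(_ i); rewrite eqxx.
by move=> tc j; case: eqP => [->//|_]; exact: hcube_lt1.
Qed.

(** Needed at the origin, whose complement carries the complexity. *)
Lemma measurable_hcube_singleton (t : T) : measurable [set t].
Proof.
rewrite [X in measurable X](_ : _ = \bigcap_(i in [set: 'I_m])
    ((fun u : T => tnth (sval u) i) @^-1` [set tnth (sval t) i])); last first.
  apply/seteqP; split=> [u /= -> //|u tu].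
  by apply/val_inj/eq_from_tnth => i; exact: (tu i I).
apply: fin_bigcap_measurable => [|i _]; first exact: finite_finset.
by rewrite -[X in measurable X]setTI; exact: measurable_coord.
Qed.

End hcube.

Section step.
Context (R : realType).
Implicit Types (k : nat) (b u : R).

(* Difference quotient of the hinge in its knot, increasing to the indicator of
   u < b; both of its knots lie in [0, b]. *)
Definition step k b u : R :=
  (Num.max (b - u) 0 - Num.max (b - b / k.+1%:R - u) 0) / (b / k.+1%:R).

Lemma step_ge0_le1 k b u : 0 < b -> 0 <= step k b u <= 1.
Proof.
move=> b0; rewrite /step; have : 0 < b / k.+1%:R by rewrite divr_gt0.
move: (b / _) => e e0; rewrite divr_ge0 ?ler_pdivrMr ?(ltW e0)//=; last first.
  by case: (leP (b - u) 0); case: (leP (b - e - u) 0); lra.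
by case: (leP (b - u) 0); case: (leP (b - e - u) 0); lra.
Qed.

Lemma measurable_step k b : measurable_fun setT (step k b).
Proof.
apply: measurable_funM => //; apply: measurable_funB; apply: measurable_maxr => //;
  exact: measurable_funB.
Qed.

Lemma step_near b u : 0 < b ->
  \forall k \near \oo, step k b u = (u < b)%R%:R.
Proof.
move=> b0; case: ltP => ub /=; last first.
  apply: nearW => k; rewrite /step.
  have : 0 < b / k.+1%:R by rewrite divr_gt0.
  move: (b / _) => e e0.
  rewrite (_ : _ - Num.max _ _ = 0) ?mul0r//.
  by case: (leP (b - u) 0); case: (leP (b - e - u) 0); lra.
(* Once [k] is at least b / (b - u), both hinges are in their linear part and differ by exactly
   [b / k.+1%:R]. *)
near=> k.
have : b / k.+1%:R <= b - u.
  rewrite ler_pdivrMr// mulrC -ler_pdivrMr ?subr_gt0//.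
  have : b / (b - u) <= k%:R by near: k; exact: nbhs_infty_ger.
  by move=> /le_trans; apply; rewrite ler_nat.
have : 0 < b / k.+1%:R by rewrite divr_gt0.
rewrite /step; move: (b / _) => e e0 eb.
rewrite (_ : _ - Num.max _ _ = e) ?divff ?gt_eqF//.
by case: (leP (b - u) 0); case: (leP (b - e - u) 0); lra.
Unshelve. all: by end_near. Qed.

End step.

Section hinge_unique.
Context (R : realType) (m : nat).
Local Notation T := (bcube R m).
Implicit Types (t : T) (x b : 'I_m -> R).

Definition box_step k b t : R := \prod_(i < m) step k (b i) (tnth (sval t) i).

Lemma bounded_measurable_box_step k b : (forall i, 0 < b i) ->
  bounded_measurable (box_step k b).
Proof.
move=> b0; apply: (@bounded_measurable_prod _ _ (fun i => step k (b i))).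
  by move=> i; exact: measurable_step.
by move=> i u _; exact: step_ge0_le1.
Qed.

(** The product of differences is expanded; [S] is the set of coordinates from which the first hinge
    is taken. *)
Lemma box_step_hinge k b t : box_step k b t =
  \sum_(S : {set 'I_m})
    (\prod_(i < m) (if i \in S then (b i / k.+1%:R)^-1 else - (b i / k.+1%:R)^-1)) *
    hinge (fun i => if i \in S then b i else b i - b i / k.+1%:R) t.
Proof.
rewrite /box_step /step.
under eq_bigr do rewrite mulrBl.
rewrite bigA_distr; apply: eq_bigr => S _; rewrite /hinge -big_split/=.
by apply: eq_bigr => i _; case: ifP => _; rewrite mulrC ?mulNr.
Qed.

Lemma cvg_integral_box_step (mu : {measure set T -> \bar R}) b :
  (mu setT < +oo)%E -> (forall i, 0 < b i) ->
  (\int[mu]_t (box_step k b t)%:E @[k --> \oo] --> mu (box b))%E.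
Proof.
move=> mufin b0; rewrite -[box b]setIT -integral_indic//; last exact: measurable_box.
pose f_ k t := (box_step k b t)%:E.
have mf k : measurable_fun setT (f_ k).
  by apply/measurable_EFinP; case: (bounded_measurable_box_step k b0).
have mi : measurable_fun setT (fun t : T => (\1_(box b) t)%:E : \bar R).
  by apply/measurable_EFinP/measurable_indic; exact: measurable_box.
have cf : {ae mu, forall t, setT t -> f_ k t @[k --> \oo] --> (\1_(box b) t)%:E}.
  apply/aeW => t _; apply: cvg_near_cst.
  (* With finitely many coordinates, all factors have reached their limits from some [k] on;
     domination is by the constant 1. *)
  have : \forall k \near \oo, forall i,
      step k (b i) (tnth (sval t) i) = (tnth (sval t) i < b i)%R%:R.
    by apply: filter_forall => i; exact: step_near.
  apply: filterS => k kE; rewrite /f_ /box_step indicE; congr EFin.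
  under eq_bigr do rewrite kE.
  case: (boolP (t \in box b)) => [|tb]; rewrite ?inE.
    by move=> tb; rewrite big1// => i _; rewrite tb.
  have /existsNP[i /negP itb] : ~ forall i, tnth (sval t) i < b i.
    by move=> h; move/negP: tb; apply; rewrite inE.
  by rewrite (bigD1 i)//= (negbTE itb) mul0r.
have ig : mu.-integrable setT (cst 1%E : T -> \bar R).
  by apply: (@bounded_measurable_integrable _ _ _ mu (cst 1)) => //; split => //;
    exists 1 => t; rewrite /= normr1.
have fg : {ae mu, forall t k, setT t -> (`|f_ k t| <= cst 1 t)%E}.
  apply/aeW => t k _; rewrite /f_ lee_fin /box_step.
  have h01 i : 0 <= step k (b i) (tnth (sval t) i) <= 1 by exact: step_ge0_le1.
  rewrite ger0_norm; last by apply: prodr_ge0 => i _; case/andP: (h01 i).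
  by apply: Num.Theory.prodr_ile1 => i _; exact: h01.
by have [_ _] := dominated_convergence measurableT mf mi cf ig fg.
Qed.

(** For each [k] the box step is a combination of hinges with knots in the unit cube, which is where
    [b i <= 1] enters. The approximating integrals agree, hence so do their limits. *)
Lemma box_eq (mu1 mu2 : {measure set T -> \bar R}) b :
  (mu1 setT < +oo)%E -> (mu2 setT < +oo)%E ->
  (forall x, (forall i, 0 <= x i <= 1) ->
    \int[mu1]_t hinge x t = \int[mu2]_t hinge x t) ->
  (forall i, 0 < b i <= 1) ->
  mu1 (box b) = mu2 (box b).
Proof.
move=> fin1 fin2 mu12 b01; have b0 i : 0 < b i by case/andP: (b01 i).
have c1 := cvg_integral_box_step fin1 b0.
have c2 := cvg_integral_box_step fin2 b0.
suff e k : (\int[mu1]_t (box_step k b t)%:E = \int[mu2]_t (box_step k b t)%:E)%E.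
  move: c1; under eq_fun do rewrite e.
  by move=> c1; exact: (cvg_unique _ c1 c2).
have fin_step (mu : {measure set T -> \bar R}) : (mu setT < +oo)%E ->
    (\int[mu]_t (box_step k b t)%:E)%E \is a fin_num.
  move=> mufin; apply: integrable_fin_num => //.
  exact: (bounded_measurable_integrable mufin (bounded_measurable_box_step k b0)).
rewrite -[LHS]fineK ?fin_step// -[RHS]fineK ?fin_step//; congr EFin.
pose x S i := if i \in (S : {set 'I_m}) then b i else b i - b i / k.+1%:R.
have x01 S i : 0 <= x S i <= 1.
  rewrite /x; have /andP[bi0 bi1] := b01 i; case: ifP => _.
    by rewrite (ltW bi0).
  rewrite subr_ge0 ler_pdivrMr// ler_peMr ?(ltW bi0) ?ler1n//=.
  by rewrite (le_trans _ bi1)// gerBl divr_ge0// ltW.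
have bm S : bounded_measurable (hinge (x S)) by exact: bounded_measurable_hinge.
transitivity (\int[mu1]_t (\sum_(S : {set 'I_m})
    (\prod_(i < m) (if i \in S then (b i / k.+1%:R)^-1 else - (b i / k.+1%:R)^-1)) *
    hinge (x S) t)).
  by congr Rintegral; apply/funext => t; exact: box_step_hinge.
transitivity (\int[mu2]_t (\sum_(S : {set 'I_m})
    (\prod_(i < m) (if i \in S then (b i / k.+1%:R)^-1 else - (b i / k.+1%:R)^-1)) *
    hinge (x S) t)).
  rewrite !Rintegral_lincomb//; apply: eq_bigr => S _; congr (_ * _).
  exact: mu12.
by congr Rintegral; apply/funext => t; rewrite box_step_hinge.
Qed.

Lemma hinge_measure_unique (mu1 mu2 : {measure set T -> \bar R}) :
  (mu1 setT < +oo)%E -> (mu2 setT < +oo)%E ->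
  (forall x, (forall i, 0 <= x i <= 1) ->
    \int[mu1]_t hinge x t = \int[mu2]_t hinge x t) ->
  forall A, measurable A -> mu1 A = mu2 A.
Proof.
move=> fin1 fin2 mu12.
have boxT : box (fun=> 1) = [set: T].
  by apply/seteqP; split => // t _ i; exact: hcube_lt1.
refine (measure_unique (@boxes R m) (fun=> setT) _ _ _ _ mu1 mu2 _ _).
- exact: measurable_boxesE.
- move=> _ _ [b1 _ <-] [b2 _ <-].
  exists (fun i => Num.min (b1 i) (b2 i)) => //.
  apply/seteqP; split => t.
    by move=> tb; split => i; move: (tb i); rewrite lt_min => /andP[].
  by move=> [t1 t2] i; rewrite lt_min t1 t2.
- by move=> _; exists (fun=> 1).
- by rewrite bigcup_const.
- move=> _ [b _ <-].
  (* Bounds above 1 can be lowered to 1 without changing the box, and a nonpositive bound makes it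
     empty. *)
  have [/forallP b0|/forallPn[i bi]] := boolP [forall i, 0 < b i].
    rewrite (_ : box b = box (fun i => Num.min (b i) 1)).
      by apply: box_eq => // i; rewrite lt_min b0 ltr01 ge_min lexx orbT.
    apply/seteqP; split => t tb i; have := tb i; rewrite lt_min.
      by move=> ->; exact: hcube_lt1.
    by case/andP.
  rewrite (_ : box b = set0) ?measure0//; apply/seteqP; split => // t tb.
  by move: (tb i) (hcube_ge0 t i) bi; rewrite -leNgt => + + ?; lra.
- by move=> _.
Qed.

Lemma hinge_charge_unique (nu1 nu2 : {charge set T -> \bar R}) :
  (forall x, (forall i, 0 <= x i <= 1) ->
    charge_integral nu1 (hinge x) = charge_integral nu2 (hinge x)) ->
  forall A, measurable A -> nu1 A = nu2 A.
Proof.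
(* Uniqueness for charges reduces to uniqueness for the finite measures p1 + n2 and p2 + n1. *)
suff main (p1 n1 p2 n2 : {measure set T -> \bar R}) :
    fin_num_fun p1 -> fin_num_fun n1 -> fin_num_fun p2 -> fin_num_fun n2 ->
    (forall x, (forall i, 0 <= x i <= 1) ->
      \int[p1]_t hinge x t - \int[n1]_t hinge x t =
      \int[p2]_t hinge x t - \int[n2]_t hinge x t) ->
    forall A, measurable A -> (p1 A - n1 A = p2 A - n2 A)%E.
  move=> nu12 A mA; rewrite !charge_jordan//.
  by apply: main => //; move=> B; exact: fin_num_measure.
move=> fp1 fn1 fp2 fn2 pn A mA.
have foo (mu : {measure set T -> \bar R}) : fin_num_fun mu -> (mu setT < +oo)%E.
  by move=> fmu; rewrite ltey_eq fmu.
have [p1oo n1oo p2oo n2oo] := And4 (foo _ fp1) (foo _ fn1) (foo _ fp2) (foo _ fn2).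
have e : (p1 A + n2 A = p2 A + n1 A)%E.
  rewrite -!measure_add_apply; apply: hinge_measure_unique mA => [||x x01].
  - exact: measure_add_lty.
  - exact: measure_add_lty.
  - have bx := bounded_measurable_hinge x01.
    by rewrite !Rintegral_measure_add//; have := pn x x01; lra.
move: e; have := fp1 A mA; have := fn1 A mA; have := fp2 A mA; have := fn2 A mA.
move: (p1 A) (p2 A) (n1 A) (n2 A) => [a1| |] [a2| |] [b1| |] [b2| |]// _ _ _ _.
rewrite -!EFinB -!EFinD => -[] e; congr EFin; lra.
Qed.

End hinge_unique.

(** Dependent ranges are needed because the number of knots varies with the coordinate. *)
Lemma prod_sum_dffun (S : comPzRingType) (I : finType) (T_ : I -> finType)
    (F : forall i, T_ i -> S) :
  \prod_i \sum_(j : T_ i) F i j =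
  \sum_(f : {dffun forall i, T_ i}) \prod_i F i (f i).
Proof.
under eq_bigr do rewrite big_tag.
rewrite bigA_distr_big_dep.
have := big_fprod (1 : S) (+%R : Monoid.add_law 0 *%R) (fun i => [ffun j => F i j]).
rewrite (reindex (@fprod_of_dffun I T_)) /=; last first.
  exists (@dffun_of_fprod I T_) => f _.
    exact: fprod_of_dffunK.
  exact: dffun_of_fprodK.
under eq_bigr do (under eq_bigr do rewrite ffunE fprodE).
move=> ->; apply: eq_bigr => f _; apply: eq_bigr => i _.
by rewrite /untag; case: eqP => // e; rewrite ffunE.
Qed.

(** * Interpolation by hat functions *)

Section hat.
Context (R : realType) (N : nat) (u : nat -> R) (u0 : u 0 = 0) (uN : u N = 1).
Context (ult : forall i j, (i < j <= N)%N -> u i < u j).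
Implicit Types (l : nat) (t : R).

(** The fraction of the cell between knots [l] and [l.+1] that lies below [t]. *)
Definition ramp l t : R :=
  (Num.min t (u l.+1) - Num.min t (u l)) / (u l.+1 - u l).

(* Hat functions of the knots, truncated at the left end point. *)
Definition hat l t : R := (if l is l'.+1 then ramp l' t else 1) - ramp l t.

Lemma ule i j : (i <= j <= N)%N -> u i <= u j.
Proof.
case/andP; rewrite leq_eqVlt => /orP[/eqP->//|ij jN].
by apply/ltW/ult; rewrite ij.
Qed.

Lemma ramp_mul l t : (l < N)%N ->
  ramp l t * (u l.+1 - u l) = Num.min t (u l.+1) - Num.min t (u l).
Proof. by move=> lN; rewrite divfK// subr_eq0 gt_eqF// ult// ltnSn. Qed.

Lemma ramp_ge0 l t : (l < N)%N -> 0 <= ramp l t.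
Proof.
move=> lN; have ul : u l < u l.+1 by rewrite ult// ltnSn.
rewrite divr_ge0 ?subr_ge0 ?(ltW ul)//.
by case: (leP t (u l.+1)); case: (leP t (u l)); lra.
Qed.

Lemma ramp_le1 l t : (l < N)%N -> ramp l t <= 1.
Proof.
move=> lN; have ul : u l < u l.+1 by rewrite ult// ltnSn.
rewrite ler_pdivrMr ?subr_gt0// mul1r.
by case: (leP t (u l.+1)); case: (leP t (u l)); lra.
Qed.

Lemma ramp_eq0 l t : (l < N)%N -> t <= u l -> ramp l t = 0.
Proof.
move=> lN tl; have ul : u l < u l.+1 by rewrite ult// ltnSn.
rewrite /ramp (_ : _ - _ = 0) ?mul0r//.
by case: (leP t (u l.+1)); case: (leP t (u l)); lra.
Qed.

Lemma ramp_eq1 l t : (l < N)%N -> u l.+1 <= t -> ramp l t = 1.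
Proof.
move=> lN tl; have ul : u l < u l.+1 by rewrite ult// ltnSn.
rewrite /ramp (_ : _ - _ = u l.+1 - u l) ?divff ?subr_eq0 ?gt_eqF//.
by case: (leP t (u l.+1)); case: (leP t (u l)); lra.
Qed.

Lemma hat_ge0 l t : (l < N)%N -> 0 <= hat l t.
Proof.
case: l => [|l] lN; rewrite /hat subr_ge0; first exact: ramp_le1.
(* A ramp starts only where the preceding one has reached 1. *)
have [tl|/ltW tl] := leP t (u l.+1); last by rewrite [leRHS]ramp_eq1 ?ramp_le1// ltnW.
by rewrite ramp_eq0// ramp_ge0// ltnW.
Qed.

Lemma hat_at0 l : (0 < l < N)%N -> hat l 0 = 0.
Proof.
case: l => // l /= lN; rewrite /hat !ramp_eq0 ?subrr// 1?ltnW//.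
- by rewrite -u0 ule// (ltnW lN).
- by rewrite -u0 ule// (ltnW (ltnW lN)).
Qed.

Lemma sum_hat n t : \sum_(l < n.+1) hat l t = 1 - ramp n t.
Proof.
elim: n => [|n IH]; first by rewrite big_ord_recl big_ord0 addr0.
by rewrite big_ord_recr/= IH /hat; lra.
Qed.

(** The sum telescopes; what is missing from 1 is the hat of the last knot, which is left out
    because every hinge vanishes there. *)
Lemma sum_hat_le1 t : \sum_(l < N) hat l t <= 1.
Proof.
move: (ramp_ge0 (l := N.-1)); case: N => [|n] h; first by rewrite big_ord0 ler01.
by rewrite sum_hat gerBl h.
Qed.

Lemma hat_le1 l t : (l < N)%N -> hat l t <= 1.
Proof.
move=> lN; apply: le_trans (sum_hat_le1 t).
rewrite (bigD1 (Ordinal lN))//= lerDl; apply: sumr_ge0 => i _.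
exact: hat_ge0.
Qed.

Lemma measurable_hat l : measurable_fun setT (hat l).
Proof.
have mr k : measurable_fun setT (ramp k).
  by apply: measurable_funM => //; apply: measurable_funB; exact: measurable_minr.
by apply: measurable_funB => //; case: l.
Qed.

(* [t |-> max (u j - t) 0] is affine between consecutive knots, hence equal to
   its interpolation by hat functions. *)
Lemma hat_interp j t : (j <= N)%N -> 0 <= t < 1 ->
  Num.max (u j - t) 0 = \sum_(l < N) hat l t * Num.max (u j - u l) 0.
Proof.
move=> jN /andP[t0 t1]; have N0 : (0 < N)%N.
  by case: N u0 uN => // -> /esym/eqP; rewrite oner_eq0.
have u_ge0 l : (l <= N)%N -> 0 <= u l by move=> lN; rewrite -u0 ule.
(* Summation by parts: on each cell, the ramp times the drop of the knot values is an increment of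
   the function min(t, min(., u j)), so the sum telescopes. *)
have step l : (l < N)%N ->
    ramp l t * (Num.max (u j - u l) 0 - Num.max (u j - u l.+1) 0) =
    Num.min t (Num.min (u l.+1) (u j)) - Num.min t (Num.min (u l) (u j)).
  move=> lN; have ul : u l < u l.+1 by rewrite ult// ltnSn.
  have [lj|jl] := ltnP l j.
    have uj : u l.+1 <= u j by rewrite ule// lj.
    have -> : Num.max (u j - u l) 0 = u j - u l by case: leP => //; lra.
    have -> : Num.max (u j - u l.+1) 0 = u j - u l.+1 by case: leP => //; lra.
    rewrite (min_idPl uj) (min_idPl (le_trans (ltW ul) uj)) -ramp_mul//.
    by congr (_ * _); lra.
  have uj : u j <= u l by rewrite ule// jl ltnW.
  have -> : Num.max (u j - u l) 0 = 0 by case: leP => //; lra.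
  have -> : Num.max (u j - u l.+1) 0 = 0 by case: leP => //; lra.
  by rewrite (min_idPr uj) (min_idPr (le_trans uj (ltW ul))) !subrr mulr0.
have partial n : (n < N)%N -> \sum_(l < n.+1) hat l t * Num.max (u j - u l) 0 =
    u j - Num.min t (Num.min (u n) (u j)) - ramp n t * Num.max (u j - u n) 0.
  elim: n => [|n IH] nN.
    have uj := u_ge0 _ jN.
    rewrite big_ord_recl big_ord0 addr0 /hat u0 subr0 (max_idPl uj) mulrBl mul1r.
    by rewrite (min_idPl uj) (min_idPr t0) subr0.
  rewrite big_ord_recr/= IH ?(ltnW nN)// /hat; have := step n (ltnW nN); lra.
case: N N0 jN uN step partial ult => // n _ jn un step partial ult'.
rewrite partial//; have := step n (ltnSn n).
(* At the last knot 1 the hinge value is 0, so the boundary term leaves [u j] minus the minimum of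
   [t] and [u j]. *)
rewrite un; have uj1 : u j <= 1.
  rewrite -un; move: jn; rewrite leq_eqVlt => /orP[/eqP->//|jn].
  by rewrite ltW// ult'// jn leqnn.
have -> : Num.max (u j - 1) 0 = 0 by case: leP => //; lra.
rewrite (min_idPr uj1).
by case: (leP t (u j)) => ?; case: (leP (u j - t) 0); lra.
Qed.

End hat.

(** * Knots of the data and points of the grid *)

Section knots.
Context (R : realType) (d n : nat) (x : 'I_n -> ucube R d) (k : 'I_d).
Local Notation s := (knots x k).

Lemma mem_knots v : (v \in s) =
  [|| v == 0, v == 1 | v \in [seq tnth (sval (x i)) k | i <- enum 'I_n]].
Proof. by rewrite mem_sort mem_undup !inE. Qed.

Lemma ucube_01 (z : ucube R d) : 0 <= tnth (sval z) k <= 1.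
Proof. by case: z => z /= /forallP. Qed.

Lemma knots_01 v : v \in s -> 0 <= v <= 1.
Proof.
rewrite mem_knots => /or3P[/eqP->|/eqP->|/mapP[i _ ->]]; last exact: ucube_01.
- by rewrite lexx ler01.
- by rewrite lexx ler01.
Qed.

Lemma knots_sorted : sorted <%R s.
Proof. by rewrite sort_lt_sorted undup_uniq. Qed.

Lemma size_knots_gt0 : (0 < size s)%N.
Proof. by have : 0 \in s by [rewrite mem_knots eqxx]; case: s. Qed.

Lemma knot_lt i j : (i < j <= nknots x k)%N -> knot x k i < knot x k j.
Proof.
case/andP=> ij jN; have js : (j < size s)%N.
  by rewrite -(prednK size_knots_gt0) ltnS.
have is_ : (i < size s)%N by exact: ltn_trans js.
by rewrite /knot (lt_sorted_ltn_nth _ knots_sorted).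
Qed.

Lemma knot_index v : v \in s -> exists2 j, (j <= nknots x k)%N & knot x k j = v.
Proof.
move=> vs; exists (index v s); last exact: nth_index.
by rewrite -ltnS /nknots (prednK size_knots_gt0) index_mem.
Qed.

Lemma knot_mem j : (j <= nknots x k)%N -> knot x k j \in s.
Proof. by move=> jN; apply: mem_nth; rewrite -(prednK size_knots_gt0) ltnS. Qed.

Lemma knot_le i j : (i <= j <= nknots x k)%N -> knot x k i <= knot x k j.
Proof.
case/andP; rewrite leq_eqVlt => /orP[/eqP->//|ij jN].
by apply/ltW/knot_lt; rewrite ij.
Qed.

Lemma knot0 : knot x k 0 = 0.
Proof.
have [|j jN j0] := @knot_index 0; first by rewrite mem_knots eqxx.
apply/eqP; rewrite eq_le -{1}j0 knot_le//=.
by case/andP: (knots_01 (knot_mem (leq0n _))).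
Qed.

Lemma knot_last : knot x k (nknots x k) = 1.
Proof.
have [|j jN j1] := @knot_index 1; first by rewrite mem_knots eqxx orbT.
apply/eqP; rewrite eq_le -{2}j1 knot_le ?jN ?leqnn// andbT.
by case/andP: (knots_01 (knot_mem (leqnn _))).
Qed.

Lemma knot_data i : exists2 j, (j <= nknots x k)%N & knot x k j = tnth (sval (x i)) k.
Proof.
apply: knot_index; rewrite mem_knots; apply/or3P/Or33/mapP.
by exists i => //; rewrite mem_enum.
Qed.

(** The index never reaches [nknots x k], the position of the knot 1; hence grid points lie in the
    half-open cube. *)
Lemma knot_ge0_lt1 (l : 'I_(nknots x k)) : 0 <= knot x k l < 1.
Proof.
apply/andP; split.
  by have /knot_mem/knots_01/andP[] := ltnW (ltn_ord l).
by rewrite -[X in _ < X]knot_last knot_lt// ltn_ord/=.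
Qed.

End knots.

Section grid.
Context (R : realType) (d s n : nat) (x : 'I_n -> ucube R d).
Implicit Types (al : alphas d s) (p : J s x).

Lemma grid_point_subproof al (l : lindex x al) :
  [forall i, 0 <= tnth [tuple knot x (enum_val i) (l i) | i < #|sval al|] i < 1].
Proof. by apply/forallP => i; rewrite tnth_mktuple knot_ge0_lt1. Qed.

Definition grid_point al (l : lindex x al) : bcube R #|sval al| :=
  (exist _ [tuple knot x (enum_val i) (l i) | i < #|sval al|]
    (grid_point_subproof l) : hcube R _).

Lemma grid_pointE al (l : lindex x al) i :
  tnth (sval (grid_point l)) i = knot x (enum_val i) (l i).
Proof. by rewrite tnth_mktuple. Qed.

(** Matches the unpenalized coefficients of the lasso with the mass at the origin, which the
    complexity ignores. *)
Lemma grid_point_eq0 al (l : lindex x al) :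
  ~~ lneq0 (Tagged (lindex x) l) -> grid_point l = hcube0 R _.
Proof.
rewrite /lneq0 negb_exists => /forallP l0; apply/val_inj/eq_from_tnth => i.
by move: (l0 i); rewrite grid_pointE tnth_nseq negbK => /eqP ->; exact: knot0.
Qed.

Lemma hinge_basisE al (l : lindex x al) (z : ucube R d) :
  hinge_basis (Tagged (lindex x) l) z =
  hinge (fun i => tnth (sval z) (enum_val i)) (grid_point l).
Proof. by apply: eq_bigr => i _; rewrite grid_pointE. Qed.

End grid.

(** * Uniqueness of the representing measures *)

Section uniqueness.
Context (R : realType) (d s : nat).
Implicit Types (al be : alphas d s) (z : ucube R d) (nu : signed_measures R d s).

Lemma ucube_restrict_subproof (A : {set 'I_d}) z :
  [forall k, 0 <= tnth [tuple if k \in A then tnth (sval z) k else 0 | k < d] k <= 1].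
Proof.
apply/forallP => k; rewrite tnth_mktuple; case: ifP => _; last by rewrite lexx ler01.
exact: ucube_01.
Qed.

Definition ucube_restrict (A : {set 'I_d}) z : ucube R d :=
  exist _ [tuple if k \in A then tnth (sval z) k else 0 | k < d]
    (ucube_restrict_subproof A z).

Lemma ucube_restrictE A z k :
  tnth (sval (ucube_restrict A z)) k = if k \in A then tnth (sval z) k else 0.
Proof. by rewrite tnth_mktuple. Qed.

Definition mars_term nu al z : R :=
  charge_integral (nu al) (fun t => hinge_prod (tnth (sval t)) z).

Lemma mars_term_eq nu al z1 z2 :
  (forall k, k \in sval al -> tnth (sval z1) k = tnth (sval z2) k) ->
  mars_term nu al z1 = mars_term nu al z2.
Proof.
move=> z12; congr charge_integral; apply/funext => t.
by apply: eq_bigr => i _; rewrite z12// enum_valP.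
Qed.

Lemma mars_term_eq0 nu al z k :
  k \in sval al -> tnth (sval z) k = 0 -> mars_term nu al z = 0.
Proof.
move=> kal zk0; rewrite /mars_term.
rewrite (_ : (fun _ => _) = cst 0).
  by rewrite charge_integralE /Rintegral !integral0 subrr.
apply/funext => t; rewrite /hinge_prod (bigD1 (enum_rank_in kal k))//=.
rewrite enum_rankK_in// zk0 sub0r.
by rewrite (max_idPr _) ?mul0r// oppr_le0 hcube_ge0.
Qed.

Lemma mars_fun_const a nu z : (forall k, tnth (sval z) k = 0) ->
  mars_fun a nu z = a.
Proof.
move=> z0; rewrite /mars_fun big1 ?addr0// => al _.
have /andP[/set0Pn[k kal] _] := svalP al.
exact: (mars_term_eq0 _ kal (z0 k)).
Qed.

(* Restricting the argument to the coordinates in [al] annihilates all the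
   terms whose index is not contained in [al]. *)
Lemma mars_term_unique a1 a2 nu1 nu2 : mars_fun a1 nu1 = mars_fun a2 nu2 ->
  forall al z, mars_term nu1 al z = mars_term nu2 al z.
Proof.
move=> e al; have [n] := ubnP #|sval al|; elim: n al => // n IH al aln z.
(* Evaluation at the origin identifies the constants. *)
have := congr1 (fun f => f (ucube_restrict finset.set0 z)) e.
rewrite /= !mars_fun_const; last 2 first.
- by move=> k; rewrite ucube_restrictE inE.
- by move=> k; rewrite ucube_restrictE inE.
move=> a12; have := congr1 (fun f => f (ucube_restrict (sval al) z)) e.
rewrite /mars_fun a12 => /addrI; rewrite (bigD1 al)//= [RHS](bigD1 al)//=.
rewrite -/(mars_term nu1 al _) -/(mars_term nu2 al _).
set s1 := \sum_(_ | _) _; set s2 := \sum_(_ | _) _.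
(* Indices properly contained in [al] are settled by induction on cardinality; every other one has a
   coordinate set to 0, which kills its term. *)
have -> : s1 = s2.
  apply: eq_bigr => be beal.
  rewrite -/(mars_term nu1 be _) -/(mars_term nu2 be _).
  have [sub|/fintype.subsetPn[k kbe kal]] := boolP (sval be \subset sval al).
    apply: IH; rewrite -ltnS; apply: leq_trans aln; rewrite ltnS.
    apply: proper_card; rewrite finset.properEneq sub andbT.
    by apply: contra beal => /eqP/val_inj->.
  by rewrite !(mars_term_eq0 _ kbe)// ucube_restrictE (negbTE kal).
move=> /addIr; rewrite !(@mars_term_eq _ _ (ucube_restrict _ z) z)//;
  by move=> k kal; rewrite ucube_restrictE kal.
Qed.

Lemma mars_charge_unique a1 a2 nu1 nu2 : mars_fun a1 nu1 = mars_fun a2 nu2 ->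
  forall al A, measurable A -> nu1 al A = nu2 al A.
Proof.
move=> /mars_term_unique e al; apply: hinge_charge_unique => y y01.
(* The point [y] of the face indexed by [al] is extended by 0 to a point of the full cube. *)
pose h k := if [pick i | enum_val i == k :> 'I_d] is Some i then y i else 0.
have h01 : [forall k, 0 <= tnth [tuple h k | k < d] k <= 1].
  apply/forallP => k; rewrite tnth_mktuple /h; case: pickP => // _.
  by rewrite lexx ler01.
pose z : ucube R d := exist _ [tuple h k | k < d] h01.
have zE i : tnth (sval z) (enum_val i) = y i.
  rewrite tnth_mktuple /h; case: pickP => [j /eqP/enum_val_inj->//|/(_ i)].
  by rewrite eqxx.
have := e al z; rewrite /mars_term.
by rewrite (_ : (fun _ => _) = hinge y)//; apply/funext => t;
  apply: eq_bigr => i _; rewrite zE.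
Qed.

End uniqueness.

(** * Discretization on the knot grid *)

Section discretization.
Context (R : realType) (d s n : nat) (x : 'I_n -> ucube R d).
Implicit Types (al : alphas d s) (nu : signed_measures R d s) (g : J s x -> R).

Definition grid_weight al (l : lindex x al) (t : bcube R #|sval al|) : R :=
  \prod_i hat (knot x (enum_val i)) (l i) (tnth (sval t) i).

Lemma hat_knot_01 k (l : 'I_(nknots x k)) u : 0 <= hat (knot x k) l u <= 1.
Proof.
by rewrite (hat_ge0 (@knot_lt _ _ _ x k))// (hat_le1 (@knot_lt _ _ _ x k)).
Qed.

Lemma bounded_measurable_grid_weight al (l : lindex x al) :
  bounded_measurable (grid_weight l).
Proof.
apply: (@bounded_measurable_prod _ _ (fun i => hat (knot x (enum_val i)) (l i))).
  by move=> i; exact: measurable_hat.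
by move=> i u _; exact: hat_knot_01.
Qed.

Lemma grid_weight_ge0 al (l : lindex x al) t : 0 <= grid_weight l t.
Proof. by apply: prodr_ge0 => i _; case/andP: (hat_knot_01 (l i) (tnth (sval t) i)). Qed.

(** The coordinates of a data point are knots, so one-variable interpolation applies in each factor;
    the product of sums is then expanded. *)
Lemma grid_weight_interp al t i :
  hinge_prod (tnth (sval t)) (x i) =
  \sum_(l : lindex x al) grid_weight l t * design i (Tagged (lindex x) l).
Proof.
rewrite /hinge_prod; transitivity (\prod_(j < #|sval al|)
    \sum_(l < nknots x (enum_val j)) hat (knot x (enum_val j)) l (tnth (sval t) j) *
      Num.max (tnth (sval (x i)) (enum_val j) - knot x (enum_val j) l) 0).
  apply: eq_bigr => j _; have [p pN <-] := knot_data x (enum_val j) i.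
  apply: (hat_interp (knot0 _ _) (knot_last _ _) (@knot_lt _ _ _ x _) pN).
  by rewrite hcube_ge0 hcube_lt1.
rewrite prod_sum_dffun; apply: eq_bigr => l _.
by rewrite big_split.
Qed.

Lemma sum_grid_weight_le1 al t : \sum_(l : lindex x al) grid_weight l t <= 1.
Proof.
rewrite -(prod_sum_dffun
  (fun (i : 'I_#|sval al|) (j : 'I_(nknots x (enum_val i))) =>
    hat (knot x (enum_val i)) j (tnth (sval t) i))).
apply: Num.Theory.prodr_ile1 => i _.
rewrite sumr_ge0 ?(sum_hat_le1 (@knot_lt _ _ _ x _))// => l _.
by case/andP: (hat_knot_01 l (tnth (sval t) i)).
Qed.

Lemma grid_weight_at0 al (l : lindex x al) :
  lneq0 (Tagged (lindex x) l) -> grid_weight l (hcube0 R _) = 0.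
Proof.
rewrite /lneq0 => /existsP[i /= li]; rewrite /grid_weight (bigD1 i)//=.
rewrite tnth_nseq (hat_at0 (knot0 _ _) (@knot_lt _ _ _ x _)) ?mul0r//.
by rewrite lt0n li ltn_ord.
Qed.

Lemma sum_grid_weight_le al (t : bcube R #|sval al|) :
  \sum_(l : lindex x al | lneq0 (Tagged (lindex x) l)) grid_weight l t <=
  \1_(~` [set (hcube0 R #|sval al| : bcube R _)]) t.
Proof.
have [->|t0] := eqVneq t (hcube0 R _ : bcube R _).
  by rewrite big1 ?indicE// => l; exact: grid_weight_at0.
rewrite indicE mem_set; last by apply/eqP.
apply: le_trans (sum_grid_weight_le1 t).
rewrite [leRHS](bigID (fun l => lneq0 (Tagged (lindex x) l)))/= lerDl.
by apply: sumr_ge0 => l _; exact: grid_weight_ge0.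
Qed.

(** The signed weight that a grid point receives when the measure is spread over the grid. *)
Definition grid_coef nu (p : J s x) : R :=
  charge_integral (nu (tag p)) (grid_weight (tagged p)).

Lemma sum_J (P : pred (J s x)) (F : J s x -> R) :
  \sum_(p | P p) F p =
  \sum_(al : alphas d s) \sum_(l : lindex x al | P (Tagged (lindex x) l))
    F (Tagged (lindex x) l).
Proof.
rewrite (sig_big_dep _ (fun al l => P (Tagged (lindex x) l))
  (fun al l => F (Tagged (lindex x) l))) /=.
by apply: eq_big => [[al l]|[al l]].
Qed.

Lemma mars_fun_grid_coef a nu i :
  mars_fun a nu (x i) = a + \sum_(p : J s x) design i p * grid_coef nu p.
Proof.
congr (_ + _); rewrite sum_J; apply: eq_bigr => al _.
under eq_bigr do rewrite /grid_coef /=.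
rewrite -charge_integral_lincomb; last exact: bounded_measurable_grid_weight.
congr charge_integral; apply/funext => t; rewrite grid_weight_interp.
by apply: eq_bigr => l _; rewrite mulrC.
Qed.

Lemma Rintegral_sum_grid_weight al
    (mu : {finite_measure set (bcube R #|sval al|) -> \bar R}) :
  ((\sum_(l : lindex x al | lneq0 (Tagged (lindex x) l))
     \int[mu]_t grid_weight l t)%:E <=
   mu (~` [set (hcube0 R #|sval al| : bcube R _)]))%E.
Proof.
set Z := ~` _; have mZ : measurable Z by exact/measurableC/measurable_hcube_singleton.
have muoo := finite_measure_lty mu.
have bw := @bounded_measurable_grid_weight al.
have -> : \sum_(l : lindex x al | lneq0 (Tagged (lindex x) l))
      \int[mu]_t grid_weight l t =
    \int[mu]_t \sum_(l : lindex x al | lneq0 (Tagged (lindex x) l))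
      1 * grid_weight l t.
  by rewrite Rintegral_lincomb//; apply: eq_bigr => l _; rewrite mul1r.
under eq_Rintegral do under eq_bigr do rewrite mul1r.
rewrite -[leRHS]fineK ?fin_num_measure// lee_fin.
have -> : fine (mu Z) = \int[mu]_t \1_Z t.
  by rewrite /Rintegral integral_indic// setIT.
have b1 : bounded_measurable (\1_Z : bcube R #|sval al| -> R).
  split; first exact: measurable_indic.
  by exists 1 => t; rewrite indicE; case: (_ \in _); rewrite ?normr1 ?normr0.
apply: le_Rintegral => //.
- apply: (bounded_measurable_integrable muoo); split.
    pose nz := [seq l <- index_enum (lindex x al) | lneq0 (Tagged (lindex x) l)].
    apply: (eq_measurable_fun (fun t => \sum_(l <- nz) grid_weight l t)).
      by move=> t _; rewrite big_filter.
    by apply: measurable_sum => l; case: (bw l).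
  exists 1 => t; rewrite ger0_norm; last first.
    by apply: sumr_ge0 => l _; exact: grid_weight_ge0.
  by apply: le_trans (sum_grid_weight_le t) _; rewrite indicE; case: (_ \in _).
- exact: (bounded_measurable_integrable muoo).
- by move=> t _; exact: sum_grid_weight_le.
Qed.

(** The integrated bound on the weights is applied to both Jordan parts, and the triangle inequality
    combines them. *)
Lemma grid_coef_le_complexity nu :
  ((\sum_(p : J s x | lneq0 p) `|grid_coef nu p|)%:E <= mars_complexity nu)%E.
Proof.
rewrite sum_J -sumEFin; apply: lee_sum => al _.
rewrite charge_tvE; apply: le_trans (leeD (Rintegral_sum_grid_weight (pos_part (nu al)))
  (Rintegral_sum_grid_weight (neg_part (nu al)))).
rewrite -EFinD lee_fin -big_split; apply: ler_sum => l _ /=.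
rewrite /grid_coef charge_integralE; apply: le_trans (ler_normB _ _) _.
by rewrite !ger0_norm// Rintegral_ge0// => t _; exact: grid_weight_ge0.
Qed.

Definition grid_charges g : signed_measures R d s := fun al =>
  discrete_charge [seq (g (Tagged (lindex x) l), grid_point l) | l : lindex x al].

Lemma lasso_funE a g : lasso_fun a g = mars_fun a (grid_charges g).
Proof.
apply/funext => z; congr (_ + _); rewrite sum_J; apply: eq_bigr => al _.
have z01 : forall i : 'I_#|sval al|, 0 <= tnth (sval z) (enum_val i) <= 1.
  by move=> i; exact: ucube_01.
rewrite (charge_integral_discrete _ (bounded_measurable_hinge z01) (hinge_ge0 _)).
rewrite big_image /=; apply: eq_bigr => l _.
by rewrite hinge_basisE.
Qed.

Lemma Vmars_lasso_fun a g :
  (Vmars s (lasso_fun a g) <= (\sum_(p : J s x | lneq0 p) `|g p|)%:E)%E.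
Proof.
(* The set is nonempty, so [Vmars] is not its default value. The representation it selects need not
   be [grid_charges g]; uniqueness identifies the two on measurable sets. *)
have /(xgetPex 0%E) : exists v : \bar R, [set v | exists b nu,
    lasso_fun a g = mars_fun b nu /\ v = mars_complexity nu] v.
  by exists (mars_complexity (grid_charges g)), a, (grid_charges g); rewrite lasso_funE.
rewrite -/(Vmars s (lasso_fun a g)) => -[b [nu [e ->]]].
have nuE := mars_charge_unique (esym (etrans (esym (lasso_funE a g)) e)).
rewrite sum_J -sumEFin; apply: lee_sum => al _.
set Z := ~` _; have mZ : measurable Z by exact/measurableC/measurable_hcube_singleton.
apply: le_trans (charge_tv_discrete_le mZ (nuE al)) _.
rewrite lee_fin big_image_cond /= big_mkcond [leRHS]big_mkcond/=.
(* An atom off the origin has a nonzero index, so its coefficient is penalized. *)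
apply: ler_sum => l _; case: ifPn => [lZ|_]; last by case: ifP.
case: ifPn => // /grid_point_eq0 l0.
by move: lZ; rewrite l0 inE => /(_ erefl).
Qed.

End discretization.

(** * Comparison with the lasso *)

Section lasso.
Context (R : realType) (d s n : nat) (x : 'I_n -> ucube R d) (y : 'I_n -> R) (V : R).
Implicit Types (a : R) (g : J s x -> R) (f : ucube R d -> R).

Lemma lasso_fun_design a g i :
  lasso_fun a g (x i) = a + \sum_(p : J s x) design i p * g p.
Proof. by congr (_ + _); apply: eq_bigr => p _; rewrite mulrC. Qed.

Lemma lasso_fun_feasible a g : \sum_(p | lneq0 p) `|g p| <= V ->
  mars_class s (lasso_fun a g) /\ (Vmars s (lasso_fun a g) <= V%:E)%E.
Proof.
move=> gV; split; first by exists a, (grid_charges g); exact: lasso_funE.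
by apply: le_trans (Vmars_lasso_fun a g) _; rewrite lee_fin.
Qed.

Lemma mars_discretize f : mars_class s f -> (Vmars s f <= V%:E)%E ->
  exists b g, \sum_(p : J s x | lneq0 p) `|g p| <= V /\
    forall i, f (x i) = lasso_fun b g (x i).
Proof.
move=> [a0 [nu0 fE0]].
(* The bound on [Vmars] concerns the representation selected by [xget], so that one is discretized
   instead of [nu0]. *)
have /(xgetPex 0%E) : exists v : \bar R, [set v | exists b (nu : signed_measures R d s),
    f = mars_fun b nu /\ v = mars_complexity nu] v.
  by exists (mars_complexity nu0), a0, nu0.
rewrite -/(Vmars s f) => -[b [nu [fE ->]]] nuV.
exists b, (grid_coef (x := x) nu); split.
  by rewrite -lee_fin; apply: le_trans nuV; exact: grid_coef_le_complexity.
by move=> i; rewrite fE mars_fun_grid_coef lasso_fun_design.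
Qed.

Definition sse f : R := \sum_(i < n) (y i - f (x i)) ^+ 2.

Lemma lasso_objectiveE a g :
  \sum_(i < n) (y i - a - \sum_(p : J s x) design i p * g p) ^+ 2 =
  sse (lasso_fun a g).
Proof.
by apply: eq_bigr => i _; rewrite lasso_fun_design opprD addrA.
Qed.

Lemma lasso_fun_solution a g :
  lasso_solutions y V (a, g) -> mars_solutions s x y V (lasso_fun a g).
Proof.
move=> [/= gV gmin]; split; first exact: lasso_fun_feasible.
move=> f [fC fV]; have [b [h [hV fE]]] := mars_discretize fC fV.
rewrite -!/(sse _); have := gmin (b, h) hV; rewrite !lasso_objectiveE /=.
by congr (_ <= _); apply: eq_bigr => i _; rewrite fE.
Qed.

(* Strict convexity of the squared loss: at the midpoint of two minimizers with
   distinct fitted values it would be strictly smaller. *)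
Lemma mars_solution_fit a g f :
  lasso_solutions y V (a, g) -> mars_solutions s x y V f ->
  forall i, f (x i) = lasso_fun a g (x i).
Proof.
move=> sol fsol; have [_ gmin] := lasso_fun_solution sol.
have [[fC fV] fmin] := fsol; have [gV gopt] := sol.
have [b [h [hV fE]]] := mars_discretize fC fV.
have le_fg := fmin _ (lasso_fun_feasible a gV).
(* The function [f] is replaced by a feasible lasso function with the same fitted values, so the
   midpoint is taken between lasso coefficients. *)
pose m p := (g p + h p) / 2.
have mV : \sum_(p | lneq0 p) `|m p| <= V.
  apply: le_trans (_ : \sum_(p | lneq0 p) (`|g p| + `|h p|) / 2 <= V).
    apply: ler_sum => p _; rewrite /m normrM (@ger0_norm _ 2^-1)//.
    by rewrite ler_pM2r// ler_normD.
  rewrite -mulr_suml big_split/= ler_pdivrMr//.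
  by move: gV hV => /=; lra.
have mE i : lasso_fun ((a + b) / 2) m (x i) =
    (lasso_fun a g (x i) + lasso_fun b h (x i)) / 2.
  rewrite /lasso_fun.
  have -> : \sum_p m p * hinge_basis p (x i) =
      (\sum_p g p * hinge_basis p (x i) + \sum_p h p * hinge_basis p (x i)) / 2.
    rewrite -big_split/= mulr_suml; apply: eq_bigr => p _.
    by rewrite /m; field.
  by field.
have le_gm := gmin _ (lasso_fun_feasible ((a + b) / 2) mV).
have le_gf := gmin _ (conj fC fV).
have : \sum_(i < n) (f (x i) - lasso_fun a g (x i)) ^+ 2 <= 0.
  (* Parallelogram identity for the residuals; the two minimizers have equal loss, at most that of
     the midpoint. *)
  have -> : \sum_(i < n) (f (x i) - lasso_fun a g (x i)) ^+ 2 =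
      2 * sse f + 2 * sse (lasso_fun a g)
      - 4 * sse (lasso_fun ((a + b) / 2) m).
    rewrite /sse !mulr_sumr -big_split -sumrB; apply: eq_bigr => i _ /=.
    by rewrite mE fE; field.
  rewrite /sse; lra.
move=> le0 i; apply/eqP; rewrite -subr_eq0 -sqrf_eq0; apply/eqP/le_anti.
rewrite sqr_ge0 andbT; apply: le_trans le0.
rewrite (bigD1 i)//= lerDl; apply: sumr_ge0 => j _; exact: sqr_ge0.
Qed.

End lasso.

(** A single data point at the origin with response 0: the one-variable hinge with knot 0 is
    unpenalized and vanishes there, so each of its multiples has zero loss. The multiples 0 and 1
    differ at the all-ones point. *)
Lemma mars_solutions_not_unique (R : realType) (d s : nat) : (1 <= s <= d)%N ->
  exists (n : nat) (x : 'I_n -> ucube R d) (y : 'I_n -> R) (V : R)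
         (f1 f2 : ucube R d -> R),
    [/\ (0 < n)%N, 0 < V, mars_solutions s x y V f1,
        mars_solutions s x y V f2 & f1 <> f2].
Proof.
case/andP=> s1 sd; have d0 : (0 < d)%N by exact: leq_trans s1 sd.
have c01 : forall c : R, 0 <= c <= 1 ->
    [forall k, 0 <= tnth [tuple c | k < d] k <= 1].
  by move=> c cP; apply/forallP => k; rewrite tnth_mktuple.
have c0 : 0 <= (0 : R) <= 1 by rewrite lexx ler01.
have c1 : 0 <= (1 : R) <= 1 by rewrite lexx ler01.
pose z0 : ucube R d := exist _ [tuple 0 | k < d] (c01 0 c0).
pose z1 : ucube R d := exist _ [tuple 1 | k < d] (c01 1 c1).
pose x (i : 'I_1) := z0.
have k0 : 'I_d := Ordinal d0.
have alP : ([set k0]%SET != finset.set0) && (#|[set k0]%SET| <= s)%N.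
  by rewrite cards1 s1 andbT; apply/set0Pn; exists k0; rewrite inE.
pose al : alphas d s := exist _ [set k0]%SET alP.
(* The knots 0 and 1 are distinct, so the index 0 is admissible. *)
have N0 k : (0 < nknots x k)%N.
  have := knot_last x k; case: (nknots x k) => // /eqP.
  by rewrite knot0 eq_sym oner_eq0.
pose l : lindex x al := [ffun i => Ordinal (N0 (enum_val i))].
pose p : J s x := Tagged (lindex x) l.
have p0 : ~~ lneq0 p.
  by rewrite /lneq0 negb_exists; apply/forallP => i; rewrite negbK ffunE.
have sol c : mars_solutions s x (fun=> 0) 1 (lasso_fun 0 (fun q => c * (q == p)%:R)).
  split.
    apply: lasso_fun_feasible; rewrite big1 ?ler01// => q q0.
    case: eqP => [qp|_]; last by rewrite mulr0 normr0.
    by move: q0; rewrite qp (negbTE p0).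
  move=> f _; rewrite big1; first by apply: sumr_ge0 => i _; exact: sqr_ge0.
  move=> i _; rewrite /lasso_fun big1 ?addr0 ?subrr ?expr0n// => q _.
  have [->|_] := eqVneq q p; last by rewrite mulr0 mul0r.
  have i0 : 'I_#|sval al| by rewrite cards1; exact: ord0.
  rewrite /hinge_basis /hinge_prod (bigD1 i0)//=.
  rewrite tnth_mktuple ffunE/= knot0 subrr (max_idPl _)//.
  by rewrite mul0r mulr0.
exists 1, x, (fun=> 0), 1, (lasso_fun 0 (fun q => 0 * (q == p)%:R)),
  (lasso_fun 0 (fun q => 1 * (q == p)%:R)); split => //.
move/(congr1 (fun f => f z1)); rewrite /lasso_fun !add0r.
rewrite big1; last by move=> q _; rewrite !mul0r.
rewrite (bigD1 p)//= big1; last by move=> q /negbTE ->; rewrite mulr0 mul0r.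
rewrite eqxx !mul1r addr0 /hinge_basis /hinge_prod big1.
  by move/esym/eqP; rewrite oner_eq0.
by move=> i _; rewrite tnth_mktuple ffunE/= knot0 subr0 (max_idPl _).
Qed.

Theorem proposition2p2 (R : realType) (d s : nat) (hs : (1 <= s <= d)%N) :
  (forall (n : nat) (x : 'I_n -> ucube R d) (y : 'I_n -> R) (V : R),
    0 < V ->
    forall (a : R) (g : J s x -> R),
      lasso_solutions y V (a, g) ->
      mars_solutions s x y V (lasso_fun a g) /\
      (forall f : ucube R d -> R, mars_solutions s x y V f ->
        forall i : 'I_n,
          f (x i) = a + \sum_(p : J s x) design i p * g p /\
          f (x i) = a + \sum_(p : J s x) g p * hinge_basis p (x i)))
  /\
  (exists (n : nat) (x : 'I_n -> ucube R d) (y : 'I_n -> R) (V : R)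
          (f1 f2 : ucube R d -> R),
    [/\ (0 < n)%N, 0 < V, mars_solutions s x y V f1,
        mars_solutions s x y V f2 & f1 <> f2]).
Proof.
split; last exact: mars_solutions_not_unique.
move=> n x y V _ a g sol; split; first exact: lasso_fun_solution.
move=> f fsol i; rewrite -lasso_fun_design.
by split; exact: (mars_solution_fit sol fsol).
Qed.
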